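(* For $j=0,1,2$ define $$f_{3j}(a)\equiv\sum_{\ell=0}^\infty(-1)^\ell\binom{-3a}{3\ell+j}.$$ Then all three of these sums satisfy the common functional equation $$3^6 f_{3j}(a+4)=f_{3j}(a),\qquad j=0,1,2.$$
   Context: Here $\binom{x}{k}=(-1)^k(-x)_k/k!$ is the generalized binomial coefficient, where $(b)_k=\Gamma(b+k)/\Gamma(b)=b(b+1)\cdots(b+k-1)$ (with $(b)_0=1$) is the Pochhammer symbol. The subscript $3j$ in $f_{3j}$ is a double index (the functions are $f_{30},f_{31},f_{32}$), not a product.
   Formalization: The equation is proved for complex a where both sums converge (in particular Re a < -4), and a = -4 is excluded because the claim fails there: 3^6 f_{30}(0) = 729 but f_{30}(-4) = 486. *)

(* Defs.v *)
From HB Require Import structures.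
From mathcomp Require Import all_boot all_order all_algebra.
From mathcomp Require Import all_classical all_reals all_analysis.
From mathcomp Require Import complex.
Set Implicit Arguments.
Unset Strict Implicit.
Unset Printing Implicit Defensive.
Import Order.TTheory GRing.Theory Num.Theory.
Import numFieldNormedType.Exports.
Local Open Scope ring_scope.
Local Open Scope complex_scope.

Definition pochhammer (F : fieldType) (b : F) (k : nat) : F :=
  \prod_(0 <= i < k) (b + i%:R).

Definition gbinom (F : fieldType) (x : F) (k : nat) : F :=
  (-1) ^+ k * pochhammer (- x) k / k`!%:R.

(* [^o] is only there to make the topology of the modulus on the complex
   numbers R[i] available to canonical structure inference. *)
Definition f3_term (R : realType) (j : nat) (a : R[i]) : nat -> R[i]^o :=
  fun l => (-1) ^+ l * gbinom (- 3 * a) (3 * l + j)%N.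

Definition f3_cvg (R : realType) (j : nat) (a : R[i]) : Prop :=
  cvgn (series (f3_term j a)).

(* Meaningful only under [f3_cvg j a]: [limn] is total, with a junk value on
   divergent sequences. *)
Definition f3 (R : realType) (j : nat) (a : R[i]) : R[i] :=
  limn (series (f3_term j a)).

(* Main.v *)
(** Put [x = -3a] and [t k = (-1)^k 'C(x, k)], so that, up to the sign
    [(-1)^j], [f_{3j}(a)] is the sum [S_j(x)] of [t] over the indices congruent
    to [j] mod 3. As [t (k+1) = t k - (x+1) t k / (k+1)], Abel's test makes all
    three [S_j(x)] converge as soon as one does. The identity
    [k t k = - x (t 0 + ... + t (k-1))] then forces [S_0 + S_1 + S_2 = 0] when
    [x <> 0]: otherwise [t (3n)] would be asymptotic to a multiple of [1/n], and
    its sum would diverge. Pascal's rule reads [S_j(x+1) = S_j(x) - S_{j-1}(x)]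
    with cyclic indices; as the sum is zero, [S_j(x+2) = -3 S_{j-1}(x)], and six
    such double steps multiply [S_j] by [3^6]. *)
Require Import Defs.
From HB Require Import structures.
From mathcomp Require Import all_boot all_order all_algebra.
From mathcomp Require Import all_classical all_reals all_analysis.
From mathcomp Require Import complex ring lra.
Set Implicit Arguments.
Unset Strict Implicit.
Unset Printing Implicit Defensive.
Import Order.TTheory GRing.Theory Num.Theory.
Import numFieldNormedType.Exports.
Local Open Scope classical_set_scope.
Local Open Scope ring_scope.
Local Open Scope complex_scope.

(** * Real series: Abel's test and comparison with the harmonic series *)

Lemma ge0_bounded_series_cvg (R : realType) (v : nat -> R) (M : R) :
  (forall n, 0 <= v n) -> (forall n, series v n <= M) -> cvgn (series v).
Proof.
move=> v0 vM; apply: nondecreasing_is_cvgn.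
  by apply/nondecreasing_seqP => n; rewrite seriesSr lerDl.
by exists M => _ [n _ <-].
Qed.

Lemma cvgn_bound (R : realType) (u : nat -> R) :
  cvgn u -> exists2 M : R, 0 < M & forall n, `|u n| <= M.
Proof.
move=> /cvg_seq_bounded /pinfty_ex_gt0 [M M0 uM].
by exists M => // n; apply: uM.
Qed.

(** Summation by parts leaves a boundary term, which is a product of convergent sequences, and a
    series dominated termwise by a constant times the telescoping differences of [b]. *)
Lemma abel_test (R : realType) (u b : nat -> R) :
  cvgn (series u) -> (forall n, b n.+1 <= b n) -> (forall n, 0 <= b n) ->
  cvgn (series (fun n => u n * b n)).
Proof.
move=> cu bS b0.
have summation_by_parts : series (fun n => u n * b n) =
    (fun n => series u n * b n +
              series (fun k => series u k.+1 * (b k - b k.+1)) n).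
  apply/funext; elim=> [|n IHn].
    by rewrite /series /= !big_geq // mul0r addr0.
  rewrite seriesSr IHn [series (fun k => series u _ * _) n.+1]seriesSr (seriesSr u n); ring.
have [M M0 uM] := cvgn_bound cu.
rewrite summation_by_parts; apply: is_cvgD.
  apply: is_cvgM => //; apply: nonincreasing_is_cvgn.
    exact/nonincreasing_seqP.
  by exists 0 => _ [n _ <-].
apply: normed_cvg; apply: (@ge0_bounded_series_cvg _ _ (M * b 0%N)) => n; first exact: normr_ge0.
(* Keeping [- b n] in the bound lets the induction telescope. *)
suff : series (fun k => `|series u k.+1 * (b k - b k.+1)|) n
       <= M * (b 0%N - b n).
  by move=> h; apply: le_trans h _; rewrite ler_pM2l// gerBl.
elim: n => [|n IHn]; first by rewrite /series /= big_geq // subrr mulr0.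
rewrite seriesSr (_ : M * _ = M * (b 0%N - b n) + M * (b n - b n.+1)); last ring.
apply: lerD => //; rewrite normrM (ger0_norm (_ : 0 <= b n - b n.+1)) ?subr_ge0 //.
by apply: ler_wpM2r; rewrite ?subr_ge0.
Qed.

(* Otherwise [u n] dominates a multiple of the harmonic series. *)
Lemma cvg_series_lim_mulSn_le0 (R : realType) (u : nat -> R) (m : R) :
  cvgn (series u) -> (fun n => n.+1%:R * u n) @ \oo --> m -> m <= 0.
Proof.
move=> cu um; rewrite leNgt; apply/negP => m0.
have /cvgr_gt /(_ (m / 2)) := um; rewrite ltr_pdivrMr // ltr_pMr // ltr1n.
move=> /(_ isT) [N _ uN].
move: cu; rewrite -(is_cvg_series_restrict N) => /cvgn_bound [M M0 uM].
apply: (@dvg_harmonic R); rewrite -(is_cvg_series_restrict N).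
apply: nondecreasing_is_cvgn.
  apply/nondecreasing_seqP => n /=; have [nN|Nn] := ltnP n N.
    by rewrite !big_geq // ltnW.
  by rewrite big_nat_recr //= lerDl invr_ge0.
exists (M * (m / 2)^-1) => _ [n _ <-] /=.
rewrite ler_pdivlMr ?divr_gt0 // mulr_suml.
apply: le_trans (uM n); apply: le_trans (ler_norm _).
apply: ler_sum_nat => k /andP[Nk _]; rewrite mulrC ler_pdivrMr // [u k * _]mulrC ltW //.
exact: uN.
Qed.

Lemma cvg_series_lim_mulSn_eq0 (R : realType) (u : nat -> R) (m : R) :
  cvgn (series u) -> (fun n => n.+1%:R * u n) @ \oo --> m -> m = 0.
Proof.
move=> cu um; apply/eqP; rewrite eq_le (cvg_series_lim_mulSn_le0 cu um) /=.
rewrite -oppr_le0; apply: (@cvg_series_lim_mulSn_le0 _ (- u)).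
  by rewrite is_cvg_seriesN.
rewrite (_ : (fun n => _) = - (fun n => n.+1%:R * u n)); first exact: cvgN.
by apply/funext => n; rewrite /= mulrN.
Qed.

(** * Transfer to complex sequences through real and imaginary parts *)

Section complex_sequences.
Variable R : realType.
Implicit Types (u : nat -> R[i]^o) (z w : R[i]).

Lemma Re_ler_normc z : `|complex.Re z| <= complex.Re `|z|.
Proof.
rewrite normc_def /= -(sqrtr_sqr (complex.Re z)) ler_sqrt ?lerDl ?sqr_ge0 //.
by rewrite addr_ge0 ?sqr_ge0.
Qed.

Lemma Im_ler_normc z : `|complex.Im z| <= complex.Re `|z|.
Proof.
rewrite normc_def /= -(sqrtr_sqr (complex.Im z)) ler_sqrt ?lerDr ?sqr_ge0 //.
by rewrite addr_ge0 ?sqr_ge0.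
Qed.

Lemma normc_ler_ReIm z :
  `|z| <= (`|complex.Re z| + `|complex.Im z|)%:C.
Proof.
rewrite normc_def lecR -[leRHS]ger0_norm ?addr_ge0 // -sqrtr_sqr ler_sqrt ?sqr_ge0 //.
rewrite sqrrD -[in leRHS](real_normK (num_real _)) !real_normK ?num_real //.
by rewrite lerD2r lerDl mulrn_wge0 // mulr_ge0.
Qed.

Lemma ReB z w : complex.Re (z - w) = complex.Re z - complex.Re w.
Proof. by case: z w => [? ?] []. Qed.

Lemma ImB z w : complex.Im (z - w) = complex.Im z - complex.Im w.
Proof. by case: z w => [? ?] []. Qed.

Lemma cvg_complexP u z :
  u @ \oo --> (z : R[i]^o) <->
  ((fun n => complex.Re (u n)) @ \oo --> complex.Re z) /\
  ((fun n => complex.Im (u n)) @ \oo --> complex.Im z).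
Proof.
split=> [uz|[/cvgrPdist_lt ru /cvgrPdist_lt iu]].
  by split; apply/cvgrPdist_lt => e e0;
    move/cvgrPdist_lt : uz => /(_ e%:C); rewrite ltcR => /(_ e0);
    apply: filterS => n; rewrite ltcE => /andP[_ /=]; apply: le_lt_trans;
    rewrite -(ReB, ImB); [exact: Re_ler_normc|exact: Im_ler_normc].
(* In the order of [R[i]], [0 < e] says that [e] is real and positive, so half of its real part
   serves for each coordinate. *)
apply/cvgrPdist_lt => e; rewrite ltcE /= => /andP[/eqP ie0 e0].
have e2 : 0 < complex.Re e / 2 by rewrite divr_gt0.
apply: filterS2 (ru _ e2) (iu _ e2) => n rn imn.
apply: le_lt_trans (normc_ler_ReIm _) _.
rewrite ltcE /= ie0 eqxx /= (splitr (complex.Re e)) ReB ImB.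
exact: ltrD.
Qed.

Lemma is_cvg_complexP u :
  cvgn u <-> cvgn (fun n => complex.Re (u n)) /\ cvgn (fun n => complex.Im (u n)).
Proof.
split=> [/cvg_ex[z /cvg_complexP[/cvgP ? /cvgP ?]]//|].
move=> [/cvg_ex[x ux] /cvg_ex[y uy]].
by apply/cvg_ex; exists (x +i* y); apply/cvg_complexP.
Qed.

Lemma Re_series u n : complex.Re (series u n) = series (fun k => complex.Re (u k)) n.
Proof. by rewrite /series /= raddf_sum. Qed.

Lemma Im_series u n : complex.Im (series u n) = series (fun k => complex.Im (u k)) n.
Proof. by rewrite /series /= raddf_sum. Qed.

Lemma is_cvg_series_complexP u :
  cvgn (series u) <-> cvgn (series (fun n => complex.Re (u n))) /\
                      cvgn (series (fun n => complex.Im (u n))).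
Proof.
rewrite is_cvg_complexP (_ : (fun n => _) = series (fun n => complex.Re (u n))).
  rewrite (_ : (fun n => complex.Im (series u n)) =
               series (fun n => complex.Im (u n))) //.
  by apply/funext => n; exact: Im_series.
by apply/funext => n; exact: Re_series.
Qed.

Lemma abs_cvg_series_complex u (v : nat -> R) :
  (forall n, complex.Re `|u n| <= v n) -> cvgn (series v) -> cvgn (series u).
Proof.
move=> uv cv.
have v0 n : 0 <= v n by apply: le_trans (uv n); apply: le_trans (Re_ler_normc _).
by apply/is_cvg_series_complexP; split; apply: normed_cvg;
  apply: (series_le_cvg _ v0 _ cv) => n; rewrite ?normr_ge0 //; apply: le_trans (uv n);
  [exact: Re_ler_normc|exact: Im_ler_normc].
Qed.

Lemma natr_mulc n z :
  n%:R * z = (n%:R * complex.Re z) +i* (n%:R * complex.Im z).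
Proof.
by rewrite -(rmorph_nat (real_complex R)); case: z => x y /=; simpc.
Qed.

Lemma natrV_mulc n z :
  n%:R^-1 * z = (n%:R^-1 * complex.Re z) +i* (n%:R^-1 * complex.Im z).
Proof.
rewrite -(rmorph_nat (real_complex R)) -(fmorphV (real_complex R)).
by case: z => x y /=; simpc.
Qed.

(** The weights are real, so the real test applies to each coordinate separately. *)
Lemma abel_test_complex u (b : nat -> nat) :
  cvgn (series u) -> (forall n, (b n <= b n.+1)%N) ->
  cvgn (series (fun n => (b n).+1%:R^-1 * u n : R[i]^o)).
Proof.
move=> /is_cvg_series_complexP[cr ci] bS; apply/is_cvg_series_complexP.
split.
- rewrite (_ : (fun n => _) =
      (fun n => complex.Re (u n) * (b n).+1%:R^-1)); last first.
    by apply/funext => n; rewrite natrV_mulc /= mulrC.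
  apply: abel_test => // n.
  by rewrite lef_pV2 ?posrE ?ltr0n // ler_nat ltnS.
- rewrite (_ : (fun n => _) =
      (fun n => complex.Im (u n) * (b n).+1%:R^-1)); last first.
    by apply/funext => n; rewrite natrV_mulc /= mulrC.
  apply: abel_test => // n.
  by rewrite lef_pV2 ?posrE ?ltr0n // ler_nat ltnS.
Qed.

Lemma cvg_series_complex_lim_mulSn_eq0 u z :
  cvgn (series u) -> (fun n => n.+1%:R * u n : R[i]^o) @ \oo --> (z : R[i]^o) ->
  z = 0.
Proof.
move=> /is_cvg_series_complexP[cr ci] /cvg_complexP[].
under eq_fun do rewrite natr_mulc /=.
move=> /(cvg_series_lim_mulSn_eq0 cr) r0.
under eq_fun do rewrite natr_mulc /=.
move=> /(cvg_series_lim_mulSn_eq0 ci) i0.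
by case: z r0 i0 => x y /= -> ->.
Qed.

End complex_sequences.

(** Summed from [K] on, the right-hand sides telescope to at most [w K], which bounds the partial
    sums of [v]. *)
Lemma telescope_series_cvg (R : realType) (v w : nat -> R) (s : R) (K : nat) :
  0 < s -> (forall n, 0 <= v n) -> (forall n, 0 <= w n) ->
  (forall n, (K <= n)%N -> s * v n <= w n - w n.+1) -> cvgn (series v).
Proof.
move=> s0 v0 w0 vw.
have vS n : s * series v (n + K)%N <= s * series v K + w K - w (n + K)%N.
  elim: n => [|n IHn]; first by rewrite add0n addrK.
  by rewrite addSn seriesSr; have := vw (n + K)%N (leq_addl _ _); lra.
apply: (@ge0_bounded_series_cvg _ _ (series v K + w K / s)) => // n.
apply: (@le_trans _ _ (series v (n + K)%N)).
  elim: K {vw vS} => [|k IHk]; first by rewrite addn0.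
  by apply: le_trans IHk _; rewrite addnS seriesSr lerDl.
rewrite -(ler_pM2l s0) mulrDr mulrCA divff ?gt_eqF // mulr1.
by have := vS n; have := w0 (n + K)%N; lra.
Qed.

(* [(-1) ^ k * 'C(x, k)]: the signs of [f3_term] cancel up to [(-1) ^ j]. *)
Definition altbinom (F : fieldType) (x : F) (k : nat) : F :=
  pochhammer (- x) k / k`!%:R.

(** * Recurrences for signed binomial coefficients *)

Section altbinom_theory.
Variable F : numFieldType.
Implicit Types (x : F) (k : nat).

Lemma altbinom0 x : altbinom x 0 = 1.
Proof. by rewrite /altbinom /pochhammer big_geq // fact0 divr1. Qed.

Lemma altbinomS x k :
  k.+1%:R * altbinom x k.+1 = (k%:R - x) * altbinom x k.
Proof.
rewrite /altbinom /pochhammer big_nat_recr //= factS natrM.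
have k1 : k.+1%:R != 0 :> F by rewrite pnatr_eq0.
have kf : k`!%:R != 0 :> F by rewrite pnatr_eq0 -lt0n fact_gt0.
by field; rewrite kf; move: k1; rewrite -natr1 addrC.
Qed.

Lemma altbinom_pascal x k :
  altbinom (x + 1) k.+1 = altbinom x k.+1 - altbinom x k.
Proof.
have nz n : n.+1%:R != 0 :> F by rewrite pnatr_eq0.
apply: (mulfI (nz k)); rewrite mulrBr !altbinomS.
elim: k => [|k IHk]; first by rewrite !altbinom0; ring.
have -> : altbinom (x + 1) k.+1 = altbinom x k.+1 - altbinom x k.
  by apply: (mulfI (nz k)); rewrite mulrBr !altbinomS.
have h := altbinomS x k.
have -> : (k.+1%:R - (x + 1)) * (altbinom x k.+1 - altbinom x k) =
  (k.+1%:R - (x + 1)) * altbinom x k.+1 - (k%:R - x) * altbinom x k.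
  by rewrite -natr1; ring.
by rewrite -h -[k.+2%:R]natr1; ring.
Qed.

(** This is [altbinomS] telescoped: [k * altbinom x k] grows by [- x * altbinom x k] from [k] to
    [k.+1]. *)
Lemma altbinom_sum x k :
  k%:R * altbinom x k = - x * \sum_(0 <= i < k) altbinom x i.
Proof.
elim: k => [|k IHk]; first by rewrite mul0r big_geq // mulr0.
by rewrite altbinomS big_nat_recr //= mulrDr -IHk; ring.
Qed.

End altbinom_theory.

(** * The three subseries modulo 3 and the action of Pascal's rule on their limits *)

Section trisected_series.
Variable K : numFieldType.
Implicit Types (x : K) (A B C : K^o) (j n : nat).

(** The index [j] may exceed 2: [tri x 3] is [tri x 0] without its first term, which closes the
    cycle of residues. *)
Definition tri x j : nat -> K^o := fun l => altbinom x (3 * l + j).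

(** The second hypothesis is what Abel's test will supply over [R[i]]; the recurrence itself holds
    over any [numFieldType]. *)
Lemma is_cvg_series_triS x j : cvgn (series (tri x j)) ->
  cvgn (series (fun l => (3 * l + j).+1%:R^-1 * tri x j l : K^o)) ->
  cvgn (series (tri x j.+1)).
Proof.
move=> cj; set g := (g in series g) => cg.
have triS l : tri x j.+1 l = tri x j l - (x + 1) * g l.
  rewrite /g /tri addnS.
  have k1 : (3 * l + j).+1%:R != 0 :> K by rewrite pnatr_eq0.
  apply: (mulfI k1); rewrite altbinomS.
  have -> : (3 * l + j)%:R - x = (3 * l + j).+1%:R - (x + 1).
    by rewrite -natr1; ring.
  by move: (_.+1%:R) k1 => k k1; field.
have -> : series (tri x j.+1) =
    (fun n => series (tri x j) n - (x + 1) * series g n).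
  apply/funext => n; rewrite /series /= mulr_sumr -sumrB.
  by apply: eq_bigr => l _; exact: triS.
by apply: is_cvgB => //; apply: is_cvgMl_tmp.
Qed.

Lemma series_tri0S x n : series (tri x 0) n.+1 = 1 + series (tri x 3) n.
Proof.
rewrite /series /= big_nat_recl // /tri altbinom0; congr (_ + _).
by apply: eq_bigr => l _; rewrite mulnS addn0 addnC.
Qed.

Lemma is_cvg_series_tri0 x :
  cvgn (series (tri x 3)) -> cvgn (series (tri x 0)).
Proof.
move=> c3; apply/cvg_ex; exists (1 + limn (series (tri x 3))).
rewrite -cvg_shiftS; under eq_fun do rewrite series_tri0S.
by apply: cvgD => //; exact: cvg_cst.
Qed.

Definition tri_limits x A B C :=
  [/\ series (tri x 0) @ \oo --> A, series (tri x 1) @ \oo --> B &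
      series (tri x 2) @ \oo --> C].

Lemma series_tri_sum x n :
  series (tri x 0) n + series (tri x 1) n + series (tri x 2) n =
  \sum_(0 <= i < 3 * n) altbinom x i.
Proof.
elim: n => [|n IHn]; first by rewrite /series /= !big_geq // !addr0.
rewrite !seriesSr mulnS addnC addn3 !big_nat_recr //= -IHn /tri !addnS addn0.
by ring.
Qed.

(* A nonzero limit here would make [tri x 3] comparable to the harmonic
   sequence. *)
Lemma tri_limits_mulSn x A B C : tri_limits x A B C ->
  (fun n => n.+1%:R * tri x 3 n : K^o) @ \oo --> (- x / 3 * (A + B + C) : K^o).
Proof.
move=> [cA cB cC].
(* This is [altbinom_sum] at index [3 * n.+1], divided by 3. *)
have -> : (fun n => n.+1%:R * tri x 3 n : K^o) = (fun n => - x / 3 *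
    (series (tri x 0) n.+1 + series (tri x 1) n.+1 + series (tri x 2) n.+1)).
  apply/funext => n; rewrite series_tri_sum mulrAC -altbinom_sum /tri.
  by rewrite -mulnSr natrM; field.
by apply: cvgMl_tmp; apply: cvgD; [apply: cvgD|]; rewrite cvg_shiftS.
Qed.

Lemma tri_limits_pascal x A B C :
  tri_limits x A B C -> tri_limits (x + 1) (A - C) (B - A) (C - B).
Proof.
move=> [cA cB cC].
have pascal j n : series (tri (x + 1) j.+1) n =
    series (tri x j.+1) n - series (tri x j) n.
  rewrite /series /= -sumrB; apply: eq_bigr => l _.
  by rewrite /tri addnS altbinom_pascal.
split.
(* The predecessor of index [3 * l + 3] is [3 * l + 2], so residue 2 lags one block behind residue
   0; the initial term 1 is the same for [x] and [x + 1]. *)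
- rewrite -cvg_shiftS.
  have -> : [sequence series (tri (x + 1) 0) n.+1]_n =
      (fun n => series (tri x 0) n.+1 - series (tri x 2) n).
    by apply/funext => n; rewrite /= !series_tri0S pascal addrA.
  by apply: cvgB => //; rewrite cvg_shiftS.
- rewrite (_ : series _ = (fun n => series (tri x 1) n - series (tri x 0) n)).
    exact: cvgB.
  by apply/funext => n; exact: pascal.
- rewrite (_ : series _ = (fun n => series (tri x 2) n - series (tri x 1) n)).
    exact: cvgB.
  by apply/funext => n; exact: pascal.
Qed.

(** Two Pascal steps turn [A] into [A + B - 2 * C], which is [-3 * C] when the total vanishes; the
    other two follow cyclically. *)
Lemma tri_limits_add2 x A B C : A + B + C = 0 -> tri_limits x A B C ->
  tri_limits (x + 2) (-3 * C) (-3 * A) (-3 * B).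
Proof.
move=> /eqP; rewrite addr_eq0 => /eqP s0.
move=> /tri_limits_pascal /tri_limits_pascal.
rewrite -addrA (_ : 1 + 1 = 2) //.
have -> : C = - (A + B) by rewrite s0 opprK.
by congr tri_limits; ring.
Qed.

Lemma tri_limits_add12 x A B C : A + B + C = 0 -> tri_limits x A B C ->
  tri_limits (x + 12) (3 ^+ 6 * A) (3 ^+ 6 * B) (3 ^+ 6 * C).
Proof.
(* Each double step rotates the residues, so three of them restore the order; the zero total has to
   be carried along. *)
have add6 y A' B' C' : A' + B' + C' = 0 -> tri_limits y A' B' C' ->
    tri_limits (y + 6) (- 3 ^+ 3 * A') (- 3 ^+ 3 * B') (- 3 ^+ 3 * C').
  move=> s0 /(tri_limits_add2 s0) l2.
  have s2 : -3 * C' + -3 * A' + -3 * B' = 0.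
    by rewrite -!mulrDr -addrA addrC s0 mulr0.
  have l4 := tri_limits_add2 s2 l2.
  have s4 : -3 * (-3 * B') + -3 * (-3 * C') + -3 * (-3 * A') = 0.
    by rewrite -!mulrDr [B' + C' + A']addrC addrA s0 !mulr0.
  move: (tri_limits_add2 s4 l4).
  by congr tri_limits; ring.
move=> s0 /(add6 _ _ _ _ s0) l6.
have s6 : - 3 ^+ 3 * A + - 3 ^+ 3 * B + - 3 ^+ 3 * C = 0.
  by rewrite -!mulrDr s0 mulr0.
by move: (add6 _ _ _ _ s6 l6); congr tri_limits; ring.
Qed.

End trisected_series.

Lemma ord3_cyclic (P : nat -> Prop) (j : 'I_3) :
  (forall k, P k -> P k.+1) -> (P 3%N -> P 0%N) -> P j ->
  [/\ P 0%N, P 1%N & P 2%N].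
Proof. by move=> PS P30; case: j => -[|[|[|//]]] /= _ Pj; split; auto. Qed.

(** * Convergence over the complex numbers and vanishing of the total *)

Section complex_trisected_series.
Variable R : realType.
Implicit Types (x : R[i]) (j k n : nat).

Lemma Re_normcM (z w : R[i]) :
  complex.Re `|z * w| = complex.Re `|z| * complex.Re `|w|.
Proof. by rewrite normrM !normc_def /= mulr0 subr0. Qed.

Lemma Re_normc_nat n : complex.Re `|n%:R : R[i]| = n%:R.
Proof. by rewrite normr_nat -(rmorph_nat (real_complex R)). Qed.

Lemma natr_subc_norm_le x : 0 < complex.Re x ->
  exists K, forall k, (K <= k)%N ->
    complex.Re `|k%:R - x| <= k%:R - complex.Re x / 2.
Proof.
case: x => a b; rewrite [complex.Re (a +i* b)]/= => a0.
(* After squaring, the claim reads [a ^+ 2 + b ^+ 2 - a ^+ 2 / 4 <= k * a]. The summand [a / 2] also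
   makes [k - a / 2] nonnegative, as squaring requires. *)
exists (Num.truncn (a / 2 + (a ^+ 2 + b ^+ 2) / a)).+1 => k Kk.
have : a / 2 + (a ^+ 2 + b ^+ 2) / a < k%:R.
  by rewrite (lt_le_trans (truncnS_gt _)) // ler_nat.
have q0 : 0 <= (a ^+ 2 + b ^+ 2) / a.
  by rewrite divr_ge0 ?(ltW a0) // addr_ge0 // sqr_ge0.
move: q0; set q := _ / a => q0 qk.
have qa : q * a = a ^+ 2 + b ^+ 2 by rewrite divfK // gt_eqF.
rewrite -(rmorph_nat (real_complex R)) normc_def /= sub0r sqrrN.
have ka : 0 <= k%:R - a / 2 by lra.
rewrite -[leRHS]ger0_norm // -sqrtr_sqr ler_sqrt ?sqr_ge0 //.
by move: a0 qk q0 qa ka; rewrite ?expr2; nra.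
Qed.

(* With [t = altbinom x], the sequence [k |t k|] eventually drops by at least
   [(Re x / 2) |t k|] at each step. *)
Lemma is_cvg_series_tri x j : 0 < complex.Re x -> cvgn (series (tri x j)).
Proof.
move=> x0; have [K xK] := natr_subc_norm_le x0.
pose v k := complex.Re `|altbinom x k|.
have v0 k : 0 <= v k by apply: le_trans (Re_ler_normc _).
have step k : (K <= k)%N ->
    complex.Re x / 2 * v k <= k%:R * v k - k.+1%:R * v k.+1.
  move=> Kk; rewrite -[k.+1%:R]Re_normc_nat -Re_normcM altbinomS Re_normcM.
  by have := ler_wpM2r (v0 k) (xK _ Kk); rewrite -/(v k); lra.
have s0 : 0 < complex.Re x / 2 by rewrite divr_gt0.
apply: (@abs_cvg_series_complex _ _ (fun l => v (3 * l + j)%N)) => //.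
apply: (@telescope_series_cvg _ _
  (fun l => (3 * l + j)%:R * v (3 * l + j)%N) _ K s0) => // [l|l Kl].
  by rewrite mulr_ge0.
have Kk : (K <= 3 * l + j)%N.
  by rewrite (leq_trans Kl) // (leq_trans _ (leq_addr _ _)) // leq_pmull.
have -> : (3 * l.+1 + j = (3 * l + j).+3)%N by rewrite mulnS -addnA addnC addn3.
(* Going from [l] to [l.+1] takes three drops: the first gives the required bound, the other two are
   only used as nonnegative. *)
have := step _ Kk; have := step _ (leqW Kk); have := step _ (leqW (leqW Kk)).
have := mulr_ge0 (ltW s0) (v0 (3 * l + j).+1).
have := mulr_ge0 (ltW s0) (v0 (3 * l + j).+2).
lra.
Qed.

Lemma is_cvg_series_tri_next x j :
  cvgn (series (tri x j)) -> cvgn (series (tri x j.+1)).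
Proof.
move=> cj; apply: (is_cvg_series_triS cj).
apply: (@abel_test_complex _ _ (fun l => 3 * l + j)%N) => // l.
by rewrite leq_add2r leq_mul2l leqnSn orbT.
Qed.

Lemma tri_limits_exist x (j : 'I_3) :
  cvgn (series (tri x j)) -> exists A B C, tri_limits x A B C.
Proof.
move=> cj.
have [c0 c1 c2] := ord3_cyclic (P := fun k => cvgn (series (tri x k)))
  (is_cvg_series_tri_next (x := x)) (@is_cvg_series_tri0 _ x) cj.
exists (limn (series (tri x 0))), (limn (series (tri x 1))),
  (limn (series (tri x 2))).
by split; [exact: c0|exact: c1|exact: c2].
Qed.

(** Convergence passes from residue 2 to [tri x 3], so the limit [- x / 3 * (A + B + C)] of
    [n.+1%:R * tri x 3 n] must be 0. *)
Lemma tri_limits_sum0 x A B C :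
  x != 0 -> tri_limits x A B C -> A + B + C = 0.
Proof.
move=> x0 l; have [_ _ /cvgP /is_cvg_series_tri_next c3] := l.
have /eqP := cvg_series_complex_lim_mulSn_eq0 c3 (tri_limits_mulSn l).
by rewrite !mulf_eq0 oppr_eq0 (negPf x0) invr_eq0 pnatr_eq0 /= => /eqP.
Qed.

End complex_trisected_series.

(** * Return to the sums [f3] and the functional equation *)

(** The two signs combine to the exponent [l + (3 * l + j) = 4 * l + j], which has the parity of
    [j]. *)
Lemma f3_term_tri (R : realType) (j : nat) (a : R[i]) :
  f3_term j a = (fun l => (-1) ^+ j * tri (-3 * a) j l : R[i]^o).
Proof.
apply/funext => l; rewrite /f3_term /gbinom /tri /altbinom !mulrA -exprD.
rewrite addnA -mulSn exprD exprM.
by rewrite (_ : (-1) ^+ 4 = 1) ?expr1n ?mul1r //; ring.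
Qed.

Lemma cvg_series_scale (K : numFieldType) (u : nat -> K^o) (A : K^o) (c : K) :
  series u @ \oo --> A -> series (fun n => c * u n : K^o) @ \oo --> (c * A : K^o).
Proof.
move=> cA; rewrite (_ : series _ = (fun n => c * series u n)).
  exact: cvgMl_tmp.
by apply/funext => n; rewrite /series /= mulr_sumr.
Qed.

Lemma is_cvg_series_signP (K : numFieldType) (j : nat) (u : nat -> K^o) :
  cvgn (series (fun n => (-1) ^+ j * u n : K^o)) <-> cvgn (series u).
Proof.
split=> /cvg_ex[A cA]; last exact: cvgP (cvg_series_scale (c := (-1) ^+ j) cA).
have -> : u = (fun n => (-1) ^+ j * ((-1) ^+ j * u n)).
  by apply/funext => n; rewrite mulrA -expr2 sqrr_sign mul1r.
exact: cvgP (cvg_series_scale (c := (-1) ^+ j) cA).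
Qed.

Section f3_tri.
Variable R : realType.
Implicit Types (a : R[i]) (A : R[i]^o) (j : nat).

Lemma f3_cvgP j a : f3_cvg j a <-> cvgn (series (tri (-3 * a) j)).
Proof. by rewrite /f3_cvg f3_term_tri; exact: is_cvg_series_signP. Qed.

Lemma f3_tri_lim j a A :
  series (tri (-3 * a) j) @ \oo --> A -> f3 j a = (-1) ^+ j * A.
Proof.
move=> cA; rewrite /f3 f3_term_tri.
exact: cvg_lim (cvg_series_scale (c := (-1) ^+ j) cA).
Qed.

End f3_tri.

Theorem proposition2 (R : realType) (j : 'I_3) :
  (forall a : R[i], complex.Re a < 0 -> f3_cvg j a) /\
  (forall a : R[i], a <> - 4 -> f3_cvg j (a + 4) -> f3_cvg j a ->
     3 ^+ 6 * f3 j (a + 4) = f3 j a).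
Proof.
split=> [a a0|a a4 /f3_cvgP c4 _].
  apply/f3_cvgP/is_cvg_series_tri.
  by rewrite mulNr -mulrN natr_mulc; case: a a0 => x y /=; lra.
(* At [a = -4] the three sums are 1, 0, 0 and their total is not zero. *)
have x0 : -3 * (a + 4) != 0.
  rewrite mulf_neq0 ?oppr_eq0 ?pnatr_eq0 // addr_eq0.
  exact/eqP.
have [A [B [C l]]] := tri_limits_exist c4.
have := tri_limits_add12 (tri_limits_sum0 x0 l) l.
(* Since [x = -3 * a], raising [x] by 12 leads from [a + 4] back to [a]. *)
have -> : -3 * (a + 4) + 12 = -3 * a by ring.
case: l => lA lB lC [lA' lB' lC'].
case: j c4 => -[|[|[|//]]] /= _ _.
- by rewrite (f3_tri_lim lA) (f3_tri_lim lA') mulrCA.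
- by rewrite (f3_tri_lim lB) (f3_tri_lim lB') mulrCA.
- by rewrite (f3_tri_lim lC) (f3_tri_lim lC') mulrCA.
Qed.
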